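(* Let $1<p<q<\infty$. Let $(\mathcal{A},\xi_0)$ be a tree rooted at $\xi_0$ with finite or countable vertex set, and let $u,w:\mathbf{V}(\mathcal{A})\to[0,\infty)$ satisfy $u(\xi)=u_j$, $w(\xi)=w_j$ for all $\xi\in\mathbf{V}_j^{\mathcal{A}}(\xi_0)$, $j\in\mathbb{Z}_+$, for some nonnegative numbers $u_j,w_j$. Suppose there exist a number $C_*\ge1$, numbers $R_0\ge R>1$, and a function $S:\mathbb{Z}_+\to(0,\infty)$ such that (i) $C_*^{-1}\frac{S(j')}{S(j)}\le \operatorname{card}\mathbf{V}^{\mathcal{A}}_{j'-j}(\xi)\le C_*\frac{S(j')}{S(j)}$ for all $j\in\mathbb{Z}_+$, all $\xi\in\mathbf{V}^{\mathcal{A}}_j(\xi_0)$ and all $j'\ge j$; (ii) $S(0)=1$; (iii) $R_0\ge \frac{S(j+1)}{S(j)}\ge R$ for all $j\in\mathbb{Z}_+$. Let $\hat{\mathfrak{S}}^{p,q}_{\mathcal{A},u,w}\in[0,\infty]$ be the operator norm of $S_{u,w,\mathcal{A}}f(\xi)=w(\xi)\sum_{\xi'\le\xi}u(\xi')f(\xi')$ from $l_q(l_p(\mathcal{A}))$ to $l_q(\mathcal{A})$. Then $$\hat{\mathfrak{S}}^{p,q}_{\mathcal{A},u,w}\asymp \sup_{j\in\mathbb{Z}_+}u_j\Big(\sum_{i\ge j}w_i^q\frac{S(i)}{S(j)}\Big)^{1/q}\asymp\sup_{\xi\in\mathbf{V}(\mathcal{A})}u(\xi)\|w\|_{l_q(\mathcal{A}_\xi)},$$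 where $A\asymp B$ means there are constants $c_1,c_2>0$ depending only on $p,q,C_*,R,R_0$ with $c_1B\le A\le c_2B$ (both sides possibly infinite).
   Context: Graphs have no loops or multiple edges. Partial order on $\mathbf{V}(\mathcal{A})$: $\xi'>\xi$ if there is a simple path $(\xi_0,\xi_1,\dots,\xi_n,\xi')$ with $\xi=\xi_k$ for some $k\in\{0,\dots,n\}$, and then the distance is $\rho(\xi,\xi')=n+1-k$; $\rho(\xi,\xi)=0$; $\xi'\ge\xi$ means $\xi'>\xi$ or $\xi'=\xi$. For $j\in\mathbb{Z}_+$ and $\xi\in\mathbf{V}(\mathcal{A})$, $\mathbf{V}^{\mathcal{A}}_j(\xi)=\{\xi'\ge\xi:\rho(\xi,\xi')=j\}$. $\mathcal{A}_\xi$ is the subtree with vertex set $\{\xi'\ge\xi\}$. $\|g\|_{l_q(\mathcal{G})}=\big(\sum_{\xi\in\mathbf{V}(\mathcal{G})}|g(\xi)|^q\big)^{1/q}$, and $l_q(\mathcal{A})$ is the space of $g:\mathbf{V}(\mathcal{A})\to\mathbb{R}$ with finite norm. The mixed norm is $\|f\|_{l_q(l_p(\mathcal{A}))}=\Big(\sum_{j=0}^\infty\Big(\sum_{\xi\in\mathbf{V}_j^{\mathcal{A}}(\xi_0)}|f(\xi)|^p\Big)^{q/p}\Big)^{1/q}$, and $l_q(l_p(\mathcal{A}))$ is the space of functions with finite such norm; the operator norm is the minimal $C$ with $\|S_{u,w,\mathcal{A}}f\|_{l_q(\mathcal{A})}\le C\|f\|_{l_q(l_p(\mathcal{A}))}$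 for all $f$. *)

(* Defs.v *)
From HB Require Import structures.
From mathcomp Require Import all_boot all_order all_algebra.
From mathcomp Require Import all_classical all_reals all_analysis.
Set Implicit Arguments. Unset Strict Implicit. Unset Printing Implicit Defensive.
Import Order.TTheory GRing.Theory Num.Theory.
Local Open Scope classical_set_scope.
Local Open Scope ring_scope.

(* A rooted tree on the vertex type V is encoded by its root and the parent
   map [par]: the root is the only fixed point reached, every vertex reaches
   the root by iterating [par]. Edges are {v, par v} for v <> root. *)
Definition is_rooted_tree (V : Type) (par : V -> V) (root : V) : Prop :=
  par root = root /\ forall v, exists n, iter n par v = root.

(* V_j(xi): vertices xi' >= xi at distance j, i.e. the upward simple path from
   xi' of length j ends at xi (and does not visit xi earlier). *)
Definition level_set (V : Type) (par : V -> V) (xi : V) (j : nat) : set V :=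
  [set xi' | iter j par xi' = xi /\ forall k, (k < j)%N -> iter k par xi' <> xi].

Definition tle (V : Type) (par : V -> V) (xi xi' : V) : Prop :=
  exists j, level_set par xi j xi'.

Definition subtree (V : Type) (par : V -> V) (xi : V) : set V := [set xi' | tle par xi xi'].

Definition Sop (R : realType) (V : choiceType) (par : V -> V)
    (u w f : V -> R) (xi : V) : R :=
  w xi * (\sum_(xi' \in [set y | tle par y xi]) (u xi' * f xi'))%R.

Definition lq_norm (R : realType) (V : choiceType) (q : R) (G : set V) (g : V -> R) : \bar R :=
  ((\esum_(xi in G) ((`|g xi| `^ q)%:E)) `^ q^-1)%E.

Definition lqlp_norm (R : realType) (V : choiceType) (par : V -> V) (root : V)
    (p q : R) (f : V -> R) : \bar R :=
  ((\esum_(j in [set: nat])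
      ((\esum_(xi in level_set par root j) ((`|f xi| `^ p)%:E)) `^ (q / p)))
    `^ q^-1)%E.

Definition op_norm (R : realType) (V : choiceType) (par : V -> V) (root : V)
    (p q : R) (u w : V -> R) : \bar R :=
  ereal_inf [set C : \bar R | (0 <= C)%E /\
    forall f : V -> R, (lqlp_norm par root p q f < +oo)%E ->
      (lq_norm q [set: V] (Sop par u w f) <= C * lqlp_norm par root p q f)%E].

Definition asymp (R : realType) (c1 c2 : R) (A B : \bar R) : Prop :=
  (c1%:E * B <= A)%E /\ (A <= c2%:E * B)%E.

(* Main.v *)
(** Testing the operator on the indicator of a vertex bounds its norm below by the
supremum over vertices, and counting the vertices of a subtree level by level
compares the two suprema. For the upper bound, write [V_i] for the [i]-th level,
[x_k] for the ancestor on level [k] of a vertex [x], and [M_k] for the [l_p] norm of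
[f] on [V_k]. It suffices to show
  [sum_{x in V_i} (sum_{k <= i} |f x_k|)^q <= C S_i sum_{k <= i} M_k^q / S_k]:
one then replaces [f] by [u f], multiplies by [w_i^q], sums over [i] and exchanges
the sums. Comparing with the largest term gives, for every [sigma > 1], pointwise
  [(sum_k |f x_k|)^q <= C sum_{k <= l} sigma^(l-k) |f x_k|^(q-p) |f x_l|^p].
Here [|f x_k|] is at most [M_k], and the sum of [|f x_l|^p] over [V_i] is at most
[C M_l^p S_i / S_l]. As [p < q], the growth of [S] makes
[M_k^(q-p) M_l^p / S_l] decay geometrically in [l - k] relative to
[M_k^q / S_k + M_l^q / S_l], faster than [sigma^(l-k)] grows if [sigma] is close
to [1]. *)
Require Import Defs.
From mathcomp Require Import all_boot all_order all_algebra.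
From mathcomp Require Import all_classical all_reals all_analysis.
From mathcomp Require Import ring lra zify.
Set Implicit Arguments. Unset Strict Implicit. Unset Printing Implicit Defensive.
Import Order.TTheory GRing.Theory Num.Theory.
Local Open Scope classical_set_scope.
Local Open Scope ring_scope.

Lemma ler_powR2r (R : realType) (r x y : R) :
  0 <= r -> 0 <= x -> x <= y -> x `^ r <= y `^ r.
Proof.
by move=> r0 x0 xy; apply: ge0_ler_powR; rewrite ?nnegrE // (le_trans x0).
Qed.

Lemma lee_poweR2r (R : realType) (r : R) (x y : \bar R) :
  0 <= r -> (0 <= x)%E -> (x <= y)%E -> (x `^ r <= y `^ r)%E.
Proof.
move=> r0 x0 xy; apply: gt0_ler_poweR => //; rewrite in_itv /= leey andbT //.
exact: le_trans xy.
Qed.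

Section MixedPowers.
Variables (R : realType) (p q : R).
Hypotheses (p_ge0 : 0 <= p) (le_pq : p <= q) (q_gt0 : 0 < q).

Lemma powRB_mulr (y : R) : y `^ (q - p) * y `^ p = y `^ q.
Proof. by rewrite -powRD subrK // gt_eqF. Qed.

Lemma powR_le_mixed (y a b : R) :
  0 <= y -> y <= a -> y <= b -> y `^ q <= a `^ (q - p) * b `^ p.
Proof.
move=> y0 ya yb; rewrite -powRB_mulr.
by apply: ler_pM; rewrite ?powR_ge0 // ler_powR2r // subr_ge0.
Qed.

Lemma mixed_powR_le_add (a b : R) :
  0 <= a -> 0 <= b -> a `^ (q - p) * b `^ p <= a `^ q + b `^ q.
Proof.
move=> a0 b0; apply: (@le_trans _ _ (Num.max a b `^ q)).
  rewrite -powRB_mulr; apply: ler_pM; rewrite ?powR_ge0 //.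
  - by rewrite ler_powR2r ?subr_ge0 // le_max lexx.
  - by rewrite ler_powR2r // le_max lexx orbT.
by case: (leP a b) => _; rewrite ?lerDl ?lerDr powR_ge0.
Qed.

End MixedPowers.

Section GeometricSums.
Variables (R : realType) (la : R).
Hypotheses (la_gt0 : 0 < la) (la_lt1 : la < 1).

Lemma sum_expr_le n : \sum_(k < n) la ^+ k <= (1 - la)^-1.
Proof.
have := @geometric_le_lim R n 1 la ler01 la_gt0.
rewrite ger0_norm ?(ltW la_gt0) // mul1r => /(_ la_lt1); apply: le_trans.
by rewrite /series /= big_mkord; apply: ler_sum => k _; rewrite mul1r.
Qed.

Lemma sum_expr_dist_le (n j : nat) : \sum_(k < n) la ^+ `|k - j|%N <= 2 / (1 - la).
Proof.
have la0 := ltW la_gt0.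
suff split_at_j : \sum_(k < n) la ^+ `|k - j|%N <=
    \sum_(k < n) la ^+ k + \sum_(d < j) la ^+ d.
  by apply: (le_trans split_at_j); rewrite mulr2n mulrDl !mul1r lerD // sum_expr_le.
elim: j n => [|j IHj] [|n].
- by rewrite !big_ord0 addr0.
- by rewrite big_ord0 addr0; under eq_bigr do rewrite subr0.
- by rewrite !big_ord0 add0r sumr_ge0 // => d _; rewrite exprn_ge0.
rewrite big_ord_recl /= subn0.
have -> : \sum_(k < n) la ^+ `|bump 0 k - j.+1|%N = \sum_(k < n) la ^+ `|k - j|%N.
  by apply: eq_bigr => k _; congr (la ^+ _); rewrite /bump; lia.
rewrite [X in _ <= _ + X]big_ord_recr [X in _ <= X + _]big_ord_recr /=.
have := IHj n; have := exprn_ge0 n la0.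
have := ler_wiXn2l la0 (ltW la_lt1) (leqnSn j).
lra.
Qed.

End GeometricSums.

Definition peak_const (R : realType) (q sigma : R) : R :=
  (2 / (1 - sigma `^ (- q^-1))) `^ q.

Lemma powR_Ninv_lt1 (R : realType) (q sigma : R) :
  0 < q -> 1 < sigma -> 0 < sigma `^ (- q^-1) < 1.
Proof.
move=> q0 sigma1; have sigma0 : 0 < sigma by apply: lt_trans sigma1.
rewrite powR_gt0 //= powRN invf_lt1 ?powR_gt0 //.
have := @gt0_ltr_powR R q^-1; rewrite invr_gt0 => /(_ q0 1 sigma).
by rewrite powR1 !nnegrE; apply => //; exact: ltW.
Qed.

Lemma powRN_exprn (R : realType) (a r : R) n :
  0 <= a -> (a `^ (- r)) ^+ n = (a ^- n) `^ r.
Proof.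
move=> a0; rewrite -powR_mulrn ?powR_ge0 // -powR_invn // -!powRrM.
by rewrite mulNr mulrC mulNr.
Qed.

Definition pair_sum (R : realType) (p q sigma : R) n (x : 'I_n -> R) : R :=
  \sum_(l < n) \sum_(k < n | (k <= l)%N)
    sigma ^+ (l - k) * (x k `^ (q - p) * x l `^ p).

Section PairSum.
Variables (R : realType) (p q sigma : R) (n : nat) (x : 'I_n -> R).
Hypotheses (p_ge0 : 0 <= p) (le_pq : p <= q) (q_gt0 : 0 < q).
Hypotheses (sigma_gt1 : 1 < sigma) (x_ge0 : forall k, 0 <= x k).

Local Notation pair k l := (sigma ^+ (l - k) * (x k `^ (q - p) * x l `^ p)).
Local Notation W := (pair_sum p q sigma x).

Let sigma_exp_ge0 d : 0 <= sigma ^+ d.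
Proof. by rewrite exprn_ge0 // (le_trans ler01) // ltW. Qed.

Let pair_ge0 (k l : 'I_n) : 0 <= pair k l.
Proof. by rewrite !mulr_ge0 ?powR_ge0 ?sigma_exp_ge0. Qed.

Lemma pair_le_pair_sum (k l : 'I_n) : (k <= l)%N -> pair k l <= W.
Proof.
move=> kl; apply: (@le_trans _ _ (\sum_(i < n | (i <= l)%N) pair i l)).
  by rewrite (bigD1 k) //= lerDl sumr_ge0.
rewrite [leRHS](bigD1 l) //= lerDl; apply: sumr_ge0 => i _.
by apply: sumr_ge0 => j _; exact: pair_ge0.
Qed.

Lemma powR_dist_le_pair_sum (k m : 'I_n) :
  x k <= x m -> sigma ^+ `|k - m|%N * x k `^ q <= W.
Proof.
move=> xkm; have [km|/ltnW mk] := leqP k m.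
  apply: le_trans (pair_le_pair_sum km); rewrite distnEr // ler_wpM2l //.
  exact: powR_le_mixed.
apply: le_trans (pair_le_pair_sum mk); rewrite distnEl // ler_wpM2l //.
exact: powR_le_mixed.
Qed.

(* If [x m] is the largest term, then every [x k] is at most [W `^ q^-1] times a
   geometric factor in [|k - m|]. *)
Lemma powR_sum_le_pair_sum : (\sum_(k < n) x k) `^ q <= peak_const q sigma * W.
Proof.
have [n0|n_gt0] := posnP n.
  rewrite big1 => [|k _]; last by have := ltn_ord k; rewrite [X in (_ < X)%N]n0.
  by rewrite powR0 ?gt_eqF // mulr_ge0 ?powR_ge0 // sumr_ge0 // => l _; rewrite sumr_ge0.
have sigma0 : 0 < sigma by apply: lt_trans sigma_gt1.
have [m x_le_xm] : exists m, forall k, x k <= x m.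
  case: (arg_maxP x (erefl : xpredT (Ordinal n_gt0))) => m _ xm.
  by exists m => k; exact: xm.
have W_ge0 : 0 <= W by apply: le_trans (pair_le_pair_sum (leqnn m)).
set la := sigma `^ (- q^-1).
have /andP[la0 la1] : 0 < la < 1 by exact: powR_Ninv_lt1.
have x_decay k : x k <= W `^ q^-1 * la ^+ `|k - m|%N.
  have := powR_dist_le_pair_sum (x_le_xm k); rewrite -ler_pdivlMl ?exprn_gt0 // => xkq_le.
  rewrite -[leLHS]powRr1 // -(mulfV (lt0r_neq0 q_gt0)) powRrM.
  apply: le_trans (ler_powR2r _ (powR_ge0 _ _) xkq_le) _; first by rewrite invr_ge0 ltW.
  by rewrite powRM ?invr_ge0 // mulrC powRN_exprn ?(ltW sigma0).
apply: (@le_trans _ _ ((2 / (1 - la) * W `^ q^-1) `^ q)).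
  apply: ler_powR2r; [exact: ltW|exact: sumr_ge0|].
  apply: le_trans (ler_sum _ (fun k _ => x_decay k)) _.
  by rewrite -mulr_sumr mulrC ler_wpM2r ?powR_ge0 ?sum_expr_dist_le.
rewrite powRM ?powR_ge0 // ?divr_ge0 ?subr_ge0 ?(ltW la1) //.
by rewrite -powRrM mulVf ?gt_eqF // powRr1.
Qed.

End PairSum.

(* When [S] grows at rate [Rr], the mixed terms of [sum_growth_pairs_le] without
   their weight decay at rate [Rr `^ (- (q - p) / q)]; the weight may use up half
   of this exponent. *)
Definition pair_ratio (R : realType) (p q Rr : R) : R := Rr `^ ((q - p) / (2 * q)).

Definition pair_const (R : realType) (p q Rr : R) : R := 4 / (1 - (pair_ratio p q Rr)^-1).

Lemma pair_ratio_gt1 (R : realType) (p q Rr : R) :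
  0 < p -> p < q -> 1 < Rr -> 1 < pair_ratio p q Rr.
Proof.
move=> p0 pq Rr1; have e0 : 0 < (q - p) / (2 * q) by rewrite divr_gt0; lra.
have := gt0_ltr_powR e0; rewrite /pair_ratio => /(_ 1 Rr).
by rewrite powR1 !nnegrE; apply => //; lra.
Qed.

Lemma growth_exprn_le (R : realFieldType) (a : R) (S : nat -> R) k d :
  0 <= a -> (forall j, a * S j <= S j.+1) -> a ^+ d * S k <= S (k + d)%N.
Proof.
move=> a0 S_growth; elim: d => [|d IHd]; first by rewrite mul1r addn0.
by rewrite exprS -mulrA addnS (le_trans _ (S_growth _)) // ler_wpM2l.
Qed.

Section GrowthPairs.
Variables (R : realType) (p q Rr : R) (S a : nat -> R).
Hypotheses (p_gt0 : 0 < p) (lt_pq : p < q) (Rr_gt1 : 1 < Rr).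
Hypotheses (S_gt0 : forall j, 0 < S j) (S_growth : forall j, Rr * S j <= S j.+1).
Hypothesis a_ge0 : forall j, 0 <= a j.

Local Notation sigma := (pair_ratio p q Rr).

Lemma growth_pair_le k l : (k <= l)%N ->
  sigma ^+ (l - k) * (a k `^ (q - p) * a l `^ p) / S l <=
  sigma^-1 ^+ (l - k) * (a k `^ q / S k + a l `^ q / S l).
Proof.
move=> kl; set d := (l - k)%N.
have q0 : 0 < q by apply: lt_trans lt_pq.
have Rr0 : 0 < Rr by apply: lt_trans Rr_gt1.
have sigma0 : 0 < sigma by rewrite powR_gt0.
pose tau := Rr `^ q^-1.
have tauE : (tau ^+ d) `^ (q - p) = sigma ^+ d * sigma ^+ d.
  rewrite -exprMn -powRD ?(gt_eqF Rr0) ?implybT // -!powR_mulrn ?powR_ge0 // -!powRrM.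
  by congr powR; field; rewrite gt_eqF.
have tauq : (tau ^+ d) `^ q = Rr ^+ d.
  rewrite -!powR_mulrn ?powR_ge0 ?(ltW Rr0) // -!powRrM; congr powR.
  by field; rewrite gt_eqF.
(* Scaling [a k] by [tau ^+ d] compensates for the growth from [S k] to [S l]. *)
rewrite exprVn ler_pdivlMl ?exprn_gt0 //.
have -> : sigma ^+ d * (sigma ^+ d * (a k `^ (q - p) * a l `^ p) / S l) =
    (tau ^+ d * a k) `^ (q - p) * a l `^ p / S l.
  by rewrite powRM ?exprn_ge0 ?powR_ge0 // tauE; field; rewrite gt_eqF.
apply: (@le_trans _ _ (((tau ^+ d * a k) `^ q + a l `^ q) / S l)).
  rewrite ler_wpM2r ?invr_ge0 ?(ltW (S_gt0 _)) //.
  apply: mixed_powR_le_add; rewrite ?(ltW p_gt0) ?(ltW lt_pq) //.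
  by rewrite mulr_ge0 ?exprn_ge0 ?powR_ge0.
rewrite mulrDl lerD2r powRM ?exprn_ge0 ?powR_ge0 // tauq ler_pdivrMr //.
rewrite mulrC mulrAC -mulrA ler_wpM2l ?powR_ge0 // ler_pdivlMr //.
by have := growth_exprn_le k d (ltW Rr0) S_growth; rewrite subnKC.
Qed.

Lemma sum_growth_pairs_le n :
  \sum_(l < n) \sum_(k < n | (k <= l)%N)
    sigma ^+ (l - k) * (a k `^ (q - p) * a l `^ p) / S l <=
  pair_const p q Rr * \sum_(k < n) a k `^ q / S k.
Proof.
have sigma1 : 1 < sigma by exact: pair_ratio_gt1.
have sigma0 : 0 < sigma by apply: lt_trans sigma1.
pose la := sigma^-1; pose m k := a k `^ q / S k.
have la0 : 0 < la by rewrite invr_gt0.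
have la1 : la < 1 by rewrite invf_lt1.
have m0 k : 0 <= m k by rewrite divr_ge0 ?powR_ge0 ?ltW.
have sum_dist_le : \sum_(l < n) \sum_(k < n) la ^+ `|k - l|%N * m l <=
    2 / (1 - la) * \sum_(l < n) m l.
  rewrite mulr_sumr; apply: ler_sum => l _.
  by rewrite -mulr_suml ler_wpM2r // sum_expr_dist_le.
apply: (@le_trans _ _ (\sum_(l < n) \sum_(k < n) la ^+ `|k - l|%N * (m k + m l))).
  apply: ler_sum => l _; rewrite big_mkcond; apply: ler_sum => k _.
  case: ifP => [kl|_]; first by rewrite (distnEr kl) growth_pair_le.
  by rewrite mulr_ge0 ?addr_ge0 ?exprn_ge0 // ltW.
under eq_bigr => l _ do (under eq_bigr => k _ do rewrite mulrDr; rewrite big_split /=).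
rewrite big_split /= exchange_big /=.
under [X in X + _]eq_bigr => k _ do under eq_bigr => l _ do rewrite distnC.
have -> : pair_const p q Rr = 2 / (1 - la) + 2 / (1 - la).
  by rewrite -mulrDl -natrD.
by rewrite mulrDl lerD.
Qed.

End GrowthPairs.

Section Esum.
Variable R : realType.
Implicit Types (T U : choiceType).

Lemma ge0_esumZl T (I : set T) (a : T -> \bar R) (c : R) :
  (forall i, (0 <= a i)%E) -> 0 <= c ->
  (\esum_(i in I) (c%:E * a i) = c%:E * \esum_(i in I) a i)%E.
Proof.
have esumZl_le d (b : T -> \bar R) : 0 <= d -> (forall i, (0 <= b i)%E) ->
    (\esum_(i in I) (d%:E * b i) <= d%:E * \esum_(i in I) b i)%E.
  move=> d0 b0; apply: ge_ereal_sup => _ [X [finX XI] <-].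
  rewrite -ge0_mule_fsumr // lee_wpmul2l ?lee_fin //.
  by apply: esum_ge; exists X.
move=> a0; rewrite le_eqVlt => /predU1P[<-|c0].
  by rewrite mul0e esum1 // => i _; rewrite mul0e.
apply/eqP; rewrite eq_le esumZl_le ?(ltW c0) //=.
rewrite -lee_pdivlMl //; apply: le_trans (esumZl_le c^-1 _ _ _).
- by apply: le_esum => i _; rewrite muleA -EFinM mulVf ?gt_eqF // mul1e.
- by rewrite invr_ge0 ltW.
- by move=> i; rewrite mule_ge0 // lee_fin ltW.
Qed.

Lemma esum_subset_le T (A B : set T) (a : T -> \bar R) :
  A `<=` B -> (\esum_(i in A) a i <= \esum_(i in B) a i)%E.
Proof.
move=> AB; apply: ereal_sup_le => _ [X [finX XA] <-].
by exists X => //; split => // x /XA /AB.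
Qed.

Lemma esum_ge_term T (A : set T) (a : T -> \bar R) x :
  A x -> (a x <= \esum_(i in A) a i)%E.
Proof.
move=> Ax; apply: esum_ge; exists [set x]; last by rewrite fsbig_set1.
by split => // _ ->.
Qed.

Lemma esum_single T (A : set T) (a : T -> \bar R) x :
  A x -> (0 <= a x)%E -> (forall y, A y -> y <> x -> a y = 0%E) ->
  (\esum_(i in A) a i)%E = a x.
Proof.
move=> Ax ax0 a_supp; have a0 y : A y -> (0 <= a y)%E.
  by move=> Ay; have [->//|/eqP yx] := eqVneq y x; rewrite a_supp.
rewrite (esumID [set x]) // [X in (_ + X)%E]esum1 ?adde0; last first.
  by move=> y [Ay yx]; rewrite a_supp.
rewrite (_ : A `&` [set x] = [set x]) ?esum_set1 //.
by apply/seteqP; split => [y [_]//|y ->].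
Qed.

Lemma exchange_esum_dep T U (I : set T) (J : T -> set U) (K : set U) (L : U -> set T)
    (a : T -> U -> \bar R) :
  (forall i j, I i /\ J i j <-> K j /\ L j i) -> (forall i j, (0 <= a i j)%E) ->
  (\esum_(i in I) \esum_(j in J i) a i j = \esum_(j in K) \esum_(i in L j) a i j)%E.
Proof.
move=> IJ_KL a0; rewrite !esum_esum //.
apply: (reindex_esum _ _ (fun ji => (ji.2, ji.1))); split.
- by move=> [j i] /= /IJ_KL.
- by move=> [j i] [j' i'] _ _ [-> ->].
- by move=> [i j] /= /IJ_KL KL; exists (j, i).
Qed.

Lemma esum_triangle (a : nat -> nat -> R) : (forall i k, 0 <= a i k) ->
  (\esum_(i in [set: nat]) (\sum_(k < i.+1) a i k)%:E =
   \esum_(k in [set: nat]) \esum_(i in [set i | (k <= i)%N]) (a i k)%:E)%E.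
Proof.
move=> a0; rewrite -(@exchange_esum_dep _ _ [set: nat] (fun i => `I_i.+1)) //.
apply: eq_esum => i _; rewrite esum_fset // => [|k _]; last by rewrite lee_fin.
by rewrite -sumEFin (fsbig_ord _ _ (fun k => (a i k)%:E)).
Qed.

Lemma esum_fibers T U (A : set T) (K : set U) (g : T -> U) (a : T -> \bar R) :
  (forall x, A x -> K (g x)) -> (forall x, (0 <= a x)%E) ->
  (\esum_(x in A) a x = \esum_(y in K) \esum_(x in A `&` g @^-1` [set y]) a x)%E.
Proof.
move=> gAK a0; rewrite -(exchange_esum_dep (I := A) (J := fun x => [set g x])) //.
  by apply: eq_esum => x _; rewrite esum_set1.
by move=> x y /=; split => [[Ax ->]|[_ [Ax ->]]]; split; auto.
Qed.

Lemma ge0_esum_sumEFin T U (A : set T) (r : seq U) (P : pred U)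
    (g : U -> T -> R) : (forall j x, 0 <= g j x) ->
  (\esum_(x in A) (\sum_(j <- r | P j) g j x)%:E =
   \sum_(j <- r | P j) \esum_(x in A) (g j x)%:E)%E.
Proof.
move=> g0; rewrite -(@esum_sum _ _ _ A r P (fun x j => (g j x)%:E)) => [|x j _ _];
  last exact: g0.
by apply: eq_esum => x _; rewrite sumEFin.
Qed.

Lemma ereal_sup_leZ (c : R) (A B : set (\bar R)) :
  0 <= c -> (forall a, A a -> exists2 b, B b & (a <= c%:E * b)%E) ->
  (ereal_sup A <= c%:E * ereal_sup B)%E.
Proof.
move=> c0 AB; apply: ge_ereal_sup => a /AB[b Bb /le_trans]; apply.
by rewrite lee_wpmul2l ?lee_fin // ereal_sup_ubound.
Qed.

End Esum.

Section Asymp.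
Variables (R : realType) (c1 c2 : R).
Hypotheses (c1_gt0 : 0 < c1) (c2_ge0 : 0 <= c2).

Lemma asymp_poweR (A B : \bar R) (r : R) :
  0 <= r -> (0 <= A)%E -> (0 <= B)%E -> asymp c1 c2 A B ->
  asymp (c1 `^ r) (c2 `^ r) (A `^ r)%E (B `^ r)%E.
Proof.
move=> r0 A0 B0 [BA AB]; have c10 := ltW c1_gt0.
by split; rewrite -poweR_EFin -poweRM ?lee_fin // lee_poweR2r // mule_ge0 ?lee_fin.
Qed.

Lemma asymp_mull (A B : \bar R) (a : R) :
  0 <= a -> asymp c1 c2 A B -> asymp c1 c2 (a%:E * A)%E (a%:E * B)%E.
Proof. by move=> a0 [BA AB]; split; rewrite muleCA lee_wpmul2l ?lee_fin. Qed.

Lemma asymp_ereal_sup (I J : Type) (a : I -> \bar R) (b : J -> \bar R)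
    (matched : I -> J -> Prop) :
  (forall i, exists j, matched i j) -> (forall j, exists i, matched i j) ->
  (forall i j, matched i j -> asymp c1 c2 (a i) (b j)) ->
  asymp c1 c2 (ereal_sup [set a i | i in [set: I]])
              (ereal_sup [set b j | j in [set: J]]).
Proof.
move=> exJ exI ab; split.
  rewrite -lee_pdivlMl //; apply: ereal_sup_leZ; first by rewrite invr_ge0 ltW.
  move=> _ [j _ <-]; have [i ij] := exI j; exists (a i); first by exists i.
  by rewrite lee_pdivlMl //; have [] := ab i j ij.
apply: ereal_sup_leZ => // _ [i _ <-]; have [j ij] := exJ i.
by exists (b j); [exists j|have [] := ab i j ij].
Qed.

End Asymp.

Lemma asymp_sym (R : realType) (k : R) (A B : \bar R) :
  0 < k -> asymp k^-1 k A B -> asymp k^-1 k B A.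
Proof. by move=> k0 [BA AB]; split; rewrite ?lee_pdivrMl // -lee_pdivrMl. Qed.

Lemma asymp_triangle (R : realType) (D k c2 : R) (A B1 B2 : \bar R) :
  0 < D -> 1 <= k -> (D + 1) * k <= c2 -> (0 <= B2)%E ->
  (B2 <= A)%E -> (A <= D%:E * B1)%E -> asymp k^-1 k B1 B2 ->
  asymp k^-1 c2 A B1 /\ asymp k^-1 c2 B1 B2 /\ asymp k^-1 c2 A B2.
Proof.
move=> D_gt0 k_ge1 c2_ge B2_ge0 B2_le_A A_le_B1 B12.
have k_gt0 : 0 < k by lra.
have [B2_le_B1 B1_le_B2] := B12.
have B1_ge0 : (0 <= B1)%E.
  by apply: le_trans B2_le_B1; rewrite mule_ge0 // lee_fin invr_ge0 ltW.
have widen c B : (0 <= B)%E -> c <= c2 -> (c%:E * B <= c2%:E * B)%E.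
  by move=> B_ge0 c_le; rewrite lee_wpmul2r ?lee_fin.
have D_le_Dk : D <= D * k by rewrite ler_peMr // ltW.
have D_le_c2 : D <= c2 by lra.
have k_le_c2 : k <= c2 by nra.
split; [|split]; split.
- rewrite lee_pdivrMl //; apply: le_trans B1_le_B2 _.
  by rewrite lee_wpmul2l ?lee_fin // ltW.
- exact: le_trans A_le_B1 (widen _ _ B1_ge0 D_le_c2).
- exact: B2_le_B1.
- exact: le_trans B1_le_B2 (widen _ _ B2_ge0 k_le_c2).
- apply: le_trans B2_le_A; rewrite -[leRHS]mul1e.
  by rewrite lee_wpmul2r ?lee_fin // invf_le1.
- have DB1_le : (D%:E * B1 <= (D * k)%:E * B2)%E.
    by rewrite EFinM -muleA lee_wpmul2l ?lee_fin // ltW.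
  by apply: le_trans A_le_B1 (le_trans DB1_le (widen _ _ B2_ge0 _)); lra.
Qed.

Section LqNorm.
Variables (R : realType) (V : choiceType) (q : R).
Hypothesis q_gt0 : 0 < q.
Implicit Types (G H : set V) (g h : V -> R).

Lemma lq_norm_ge0 G g : (0 <= lq_norm q G g)%E.
Proof. exact: poweR_ge0. Qed.

Lemma esum_powR_ge0 G g : (0 <= \esum_(x in G) (`|g x| `^ q)%:E)%E.
Proof. by apply: esum_ge0 => x _; rewrite lee_fin powR_ge0. Qed.

Lemma lq_normX G g : (lq_norm q G g `^ q = \esum_(x in G) (`|g x| `^ q)%:E)%E.
Proof.
by rewrite /lq_norm -poweRrM mulVf ?gt_eqF // poweRe1 // esum_powR_ge0.
Qed.

Lemma eq_lq_norm G g h : (forall x, G x -> g x = h x) -> lq_norm q G g = lq_norm q G h.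
Proof.
by move=> gh; congr (_ `^ _)%E; apply: eq_esum => x Gx; rewrite gh.
Qed.

Lemma lq_normZ G g (c : R) :
  (lq_norm q G (fun x => c * g x)%R = `|c|%:E * lq_norm q G g)%E.
Proof.
rewrite /lq_norm -[X in (X%:E * _)%E]powRr1 // -(mulfV (lt0r_neq0 q_gt0)) powRrM.
rewrite -poweR_EFin -poweRM ?esum_powR_ge0 ?lee_fin ?powR_ge0 //.
rewrite -ge0_esumZl ?powR_ge0 //.
by congr (_ `^ _)%E; apply: eq_esum => x _; rewrite normrM powRM // EFinM.
Qed.

Lemma lq_norm_subset_le G H g : G `<=` H -> (lq_norm q G g <= lq_norm q H g)%E.
Proof.
move=> GH; apply: lee_poweR2r; [by rewrite invr_ge0 ltW|exact: esum_powR_ge0|].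
exact: esum_subset_le.
Qed.

Lemma lq_norm_set1 g x : lq_norm q [set x] g = `|g x|%:E.
Proof.
rewrite /lq_norm esum_set1 ?lee_fin ?powR_ge0 // poweR_EFin.
by rewrite -powRrM mulfV ?gt_eqF // powRr1.
Qed.

Lemma normr_le_lq_norm G g x : G x -> (`|g x|%:E <= lq_norm q G g)%E.
Proof. by move=> Gx; rewrite -lq_norm_set1; apply: lq_norm_subset_le => _ ->. Qed.

Lemma lq_norm_indic1 G x : lq_norm q G (\1_[set x] : V -> R) = (\1_G x)%:E.
Proof.
have off y : y <> x -> `|\1_[set x] y : R| `^ q = 0.
  by move=> yx; rewrite indicE memNset // normr0 powR0 // gt_eqF.
rewrite /lq_norm; have [Gx|Gx] := pselect (G x).
  rewrite (@esum_single _ _ _ _ x) ?lee_fin ?powR_ge0 // => [|y _ /off -> //].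
  by rewrite !indicE !mem_set // normr1 powR1 poweR1r.
rewrite esum1 => [|y Gy]; last by rewrite off // => yx; apply: Gx; rewrite -yx.
by rewrite poweR0r ?invr_eq0 ?gt_eqF // indicE memNset.
Qed.

End LqNorm.

Section RootedTree.
Variables (V : Type) (par : V -> V).
Implicit Types v x : V.

Lemma level_set_uniq v x i j :
  level_set par v i x -> level_set par v j x -> i = j.
Proof.
move=> [x_i not_i] [x_j not_j].
by have [ij|ji|//] := ltngtP i j; [case: (not_j i ij)|case: (not_i j ji)].
Qed.

Lemma trivIset_level_set v : trivIset [set: nat] (level_set par v).
Proof. by move=> i j _ _ [x [x_i /(level_set_uniq x_i)]]. Qed.

Definition ancestor (i k : nat) x : V := iter (i - k) par x.

Variable root : V.

Lemma level_set_ancestor i k x :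
  (k <= i)%N -> level_set par root i x -> level_set par root k (ancestor i k x).
Proof.
move=> ki [x_i not_i]; split; first by rewrite -iterD subnKC.
by move=> l lk; rewrite -iterD; apply: not_i; lia.
Qed.

Lemma ancestor_level_set i k x :
  (k <= i)%N -> level_set par root i x -> level_set par (ancestor i k x) (i - k) x.
Proof.
move=> ki xi; split => // l l_lt lE.
have li : (i - l <= i)%N by lia.
have := level_set_ancestor li xi; rewrite /ancestor subKn; last by lia.
by rewrite lE => /(level_set_uniq (level_set_ancestor ki xi)); lia.
Qed.

Hypothesis treeP : is_rooted_tree par root.

Lemma level_setP x : exists j, level_set par root j x.
Proof.
have [_ /(_ x) [n nx]] := treeP.
have : exists n, `[< iter n par x = root >] by exists n; apply/asboolP.
move=> /ex_minnP [j /asboolP jx jmin]; exists j; split => // k kj kx.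
by have := jmin k (asboolT kx); rewrite leqNgt kj.
Qed.

Lemma level_set_trans v x j k :
  level_set par root j v -> level_set par v k x -> level_set par root (j + k) x.
Proof.
move=> vj [xk not_k]; have [i xi] := level_setP x.
have [ki|ik] := leqP k i.
  have := level_set_ancestor (leq_subr k i) xi.
  rewrite /ancestor subKn // xk => /(level_set_uniq vj) ->.
  by rewrite subnK.
have iter_root n : iter n par root = root by elim: n => //= n ->; case: treeP.
have [x_root _] := xi; case: (not_k i ik); rewrite x_root -xk.
by rewrite -(subnK (ltnW ik)) iterD x_root iter_root.
Qed.

Lemma bigcup_level_set : \bigcup_j level_set par root j = [set: V].
Proof. by apply/seteqP; split => // x _; have [j xj] := level_setP x; exists j. Qed.

Lemma subtreeE v : subtree par v = \bigcup_k level_set par v k.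
Proof. by apply/seteqP; split => x [k]; [exists k|exists k]. Qed.

Lemma tle_ancestorP i x y : level_set par root i x ->
  tle par y x <-> exists2 k, (k <= i)%N & ancestor i k x = y.
Proof.
move=> xi; split => [[d yd]|[k ki <-]]; last first.
  by exists (i - k)%N; exact: ancestor_level_set.
have [j yj] := level_setP y; have := level_set_uniq (level_set_trans yj yd) xi.
move=> <-; exists j; first exact: leq_addr.
by rewrite /ancestor addKn; case: yd.
Qed.

Lemma ancestor_inj i k l x : (k <= i)%N -> (l <= i)%N ->
  level_set par root i x -> ancestor i k x = ancestor i l x -> k = l.
Proof.
move=> ki li xi kl; have := level_set_ancestor ki xi.
by rewrite kl => /level_set_uniq; apply; exact: level_set_ancestor.
Qed.

End RootedTree.

Definition radial (R : realType) (V : Type) (par : V -> V) (root : V)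
    (h : V -> R) (hj : nat -> R) : Prop :=
  forall j x, level_set par root j x -> h x = hj j.

Section RootedTreeSums.
Variables (R : realType) (V : choiceType) (par : V -> V) (root : V).
Hypothesis treeP : is_rooted_tree par root.

Lemma radial_ge0 (h : V -> R) (hj : nat -> R) :
  (forall j, 0 <= hj j) -> radial par root h hj -> forall x, 0 <= h x.
Proof. by move=> hj0 hE x; have [j xj] := level_setP treeP x; rewrite (hE j x xj). Qed.

Lemma Sop_ancestors (u w f : V -> R) i x : level_set par root i x ->
  Sop par u w f x =
  w x * \sum_(k < i.+1) u (ancestor par i k x) * f (ancestor par i k x).
Proof.
move=> xi; rewrite /Sop; congr (_ * _).
rewrite (fsbig_ord _ _ (fun k => u (ancestor par i k x) * f (ancestor par i k x))).
apply: (@reindex_fsbig _ _ _ _ _ (fun k => ancestor par i k x)); split.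
- by move=> k /= ki; apply/(tle_ancestorP treeP _ xi); exists k.
- move=> k l /set_mem /= ki /set_mem /= li; exact: ancestor_inj xi.
- by move=> y /= /(tle_ancestorP treeP _ xi) [k ki <-]; exists k.
Qed.

Lemma esum_levels (a : V -> \bar R) : (forall x, (0 <= a x)%E) ->
  (\esum_(x in [set: V]) a x =
   \esum_(i in [set: nat]) \esum_(x in level_set par root i) a x)%E.
Proof.
move=> a0; rewrite -esum_bigcupT //; last exact: trivIset_level_set.
by rewrite bigcup_level_set.
Qed.

Lemma esum_subtree (v : V) (a : V -> \bar R) : (forall x, (0 <= a x)%E) ->
  (\esum_(x in subtree par v) a x =
   \esum_(k in [set: nat]) \esum_(x in level_set par v k) a x)%E.
Proof.
by move=> a0; rewrite subtreeE esum_bigcupT //; exact: trivIset_level_set.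
Qed.

Lemma lqlp_normE (p q : R) (f : V -> R) :
  (lqlp_norm par root p q f =
   (\esum_(j in [set: nat]) lq_norm p (level_set par root j) f `^ q) `^ q^-1)%E.
Proof.
congr (_ `^ _)%E; apply: eq_esum => j _.
by rewrite /lq_norm -poweRrM [p^-1 * q]mulrC.
Qed.

Lemma lq_norm_level_lty (p q : R) (f : V -> R) j : 0 < q ->
  (lqlp_norm par root p q f < +oo)%E -> (lq_norm p (level_set par root j) f < +oo)%E.
Proof.
move=> q0; rewrite lqlp_normE => /lty_poweRy => f_fin.
apply: (@lty_poweRy _ _ q); first by rewrite gt_eqF.
apply: le_lt_trans (f_fin _); last by rewrite gt_eqF ?invr_gt0.
exact: (@esum_ge_term _ _ _ (fun j => lq_norm p (level_set par root j) f `^ q)%E).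
Qed.

End RootedTreeSums.

Definition regular_growth (R : realType) (V : choiceType) (par : V -> V) (root : V)
    (Cst : R) (S : nat -> R) : Prop :=
  forall j xi j', level_set par root j xi -> (j <= j')%N ->
    ((Cst^-1 * (S j' / S j))%:E <= \esum_(y in level_set par xi (j' - j)) 1
     /\ \esum_(y in level_set par xi (j' - j)) 1 <= (Cst * (S j' / S j))%:E)%E.

Definition tail_norm (R : realType) (q : R) (wj S : nat -> R) (j : nat) : \bar R :=
  ((\esum_(i in [set i : nat | (j <= i)%N]) (wj i `^ q * (S i / S j))%:E) `^ q^-1)%E.

Definition tail_norm_sup (R : realType) (q : R) (uj wj S : nat -> R) : \bar R :=
  ereal_sup [set ((uj j)%:E * tail_norm q wj S j)%E | j in [set: nat]].

Definition subtree_norm_sup (R : realType) (V : choiceType) (par : V -> V) (q : R)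
    (u w : V -> R) : \bar R :=
  ereal_sup [set ((u v)%:E * lq_norm q (subtree par v) w)%E | v in [set: V]].

Section TailNorm.
Variables (R : realType) (q : R) (uj wj S : nat -> R).
Hypotheses (q_gt0 : 0 < q) (S_gt0 : forall j, 0 < S j).

Let term_ge0 i j : 0 <= wj i `^ q * (S i / S j).
Proof. by rewrite mulr_ge0 ?powR_ge0 ?divr_ge0 ?ltW. Qed.

Lemma tail_normX j : (tail_norm q wj S j `^ q =
  \esum_(i in [set i : nat | (j <= i)%N]) (wj i `^ q * (S i / S j))%:E)%E.
Proof.
rewrite /tail_norm -poweRrM mulVf ?gt_eqF // poweRe1 //.
by apply: esum_ge0 => i _; rewrite lee_fin term_ge0.
Qed.

Lemma esum_tail_norm_le (M : nat -> R) (b : R) :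
  (forall j, 0 <= uj j) -> (forall j, 0 <= M j) ->
  (forall k, (uj k)%:E * tail_norm q wj S k <= b%:E)%E ->
  (\esum_(i in [set: nat])
     (\sum_(k < i.+1) (uj k * M k) `^ q * (wj i `^ q * (S i / S k)))%:E <=
   (b `^ q)%:E * \esum_(k in [set: nat]) (M k `^ q)%:E)%E.
Proof.
move=> uj0 M0 uTb.
pose term i k := (uj k * M k) `^ q * (wj i `^ q * (S i / S k)).
rewrite (esum_triangle (a := term)) => [|i k]; last by rewrite mulr_ge0 ?powR_ge0 ?term_ge0.
rewrite -ge0_esumZl ?powR_ge0 // => [|k]; last by rewrite lee_fin powR_ge0.
apply: le_esum => k _; under eq_esum do rewrite EFinM.
rewrite ge0_esumZl ?powR_ge0 // => [|i]; last by rewrite lee_fin term_ge0.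
rewrite powRM // mulrC EFinM -muleA [leRHS]muleC lee_wpmul2l ?lee_fin ?powR_ge0 //.
rewrite -tail_normX -!poweR_EFin -poweRM ?lee_fin ?poweR_ge0 //.
by rewrite lee_poweR2r ?(ltW q_gt0) // mule_ge0 ?lee_fin ?poweR_ge0.
Qed.

End TailNorm.

Section RegularTree.
Variables (R : realType) (V : choiceType) (par : V -> V) (root : V).
Variables (Cst : R) (S : nat -> R).
Hypotheses (treeP : is_rooted_tree par root) (Cst_gt0 : 0 < Cst).
Hypotheses (S_gt0 : forall j, 0 < S j) (regP : regular_growth par root Cst S).

Lemma level_set_neq0 j : exists x, level_set par root j x.
Proof.
apply: contrapT => /forallNP no_vertex.
have root0 : level_set par root 0 root by split.
have [+ _] := regP root0 (leq0n j).
rewrite subn0 esum1 => [|y /no_vertex //].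
by rewrite leNgt lte_fin mulr_gt0 ?invr_gt0 // divr_gt0.
Qed.

Lemma esum_ancestor_le (F : V -> R) i k : (forall x, 0 <= F x) -> (k <= i)%N ->
  (\esum_(x in level_set par root i) (F (ancestor par i k x))%:E <=
   (Cst * (S i / S k))%:E * \esum_(y in level_set par root k) (F y)%:E)%E.
Proof.
move=> F0 ki; rewrite (esum_fibers (K := level_set par root k) (g := ancestor par i k));
  last 2 first.
- by move=> x; exact: level_set_ancestor.
- by move=> x; rewrite lee_fin.
rewrite -ge0_esumZl ?mulr_ge0 ?invr_ge0 ?(ltW Cst_gt0) ?(ltW (S_gt0 _)) //.
apply: le_esum => y yk; have [_ card_le] := regP yk ki.
apply: (@le_trans _ _ ((F y)%:E * \esum_(x in level_set par y (i - k)) 1)%E); last first.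
  by rewrite muleC lee_wpmul2r ?lee_fin.
rewrite -ge0_esumZl //.
rewrite (_ : _ `&` _ = level_set par y (i - k)).
  by apply: le_esum => x [xy _]; rewrite /ancestor xy mule1.
apply/seteqP; split => x; first by move=> [xi <-]; exact: ancestor_level_set xi.
move=> xy; split; last by case: xy.
by have := level_set_trans treeP yk xy; rewrite subnKC.
Qed.

Lemma esum_subtree_asymp (a : nat -> R) (b : V -> R) j v :
  (forall i, 0 <= a i) -> radial par root b a -> level_set par root j v ->
  asymp Cst^-1 Cst (\esum_(x in subtree par v) (b x)%:E)%E
    (\esum_(i in [set i : nat | (j <= i)%N]) (a i * (S i / S j))%:E)%E.
Proof.
move=> a0 ba vj.
have b0 := radial_ge0 treeP a0 ba.
pose N k := (\esum_(x in level_set par v k) 1 : \bar R)%E.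
have -> : (\esum_(x in subtree par v) (b x)%:E =
    \esum_(k in [set: nat]) ((a (j + k)%N)%:E * N k))%E.
  rewrite esum_subtree => [|x]; last by rewrite lee_fin.
  apply: eq_esum => k _; rewrite -ge0_esumZl //; apply: eq_esum => x xk.
  by rewrite (ba _ _ (level_set_trans treeP vj xk)) mule1.
have -> : (\esum_(i in [set i : nat | (j <= i)%N]) (a i * (S i / S j))%:E =
    \esum_(k in [set: nat]) (a (j + k)%N * (S (j + k)%N / S j))%:E)%E.
  apply: (@reindex_esum _ _ _ _ _ (addn j)); split.
  - by move=> k _; exact: leq_addr.
  - by move=> k l _ _ /addnI.
  - by move=> i /= ji; exists (i - j)%N; rewrite ?subnKC.
have NS k : ((Cst^-1 * (S (j + k)%N / S j))%:E <= N k)%E /\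
    (N k <= (Cst * (S (j + k)%N / S j))%:E)%E.
  by have := regP vj (leq_addr k j); rewrite addKn.
have aS0 k : (0 <= (a (j + k)%N * (S (j + k)%N / S j))%:E)%E.
  by rewrite lee_fin mulr_ge0 // divr_ge0 ?ltW.
split; rewrite -ge0_esumZl ?invr_ge0 ?(ltW Cst_gt0) //; apply: le_esum => k _;
  have [NS_ge NS_le] := NS k; rewrite -EFinM mulrCA EFinM lee_wpmul2l ?lee_fin //.
Qed.

Lemma lq_norm_subtree_asymp (q : R) (w : V -> R) (wj : nat -> R) j v :
  0 < q -> (forall i, 0 <= wj i) -> radial par root w wj -> level_set par root j v ->
  asymp (Cst `^ q^-1)^-1 (Cst `^ q^-1) (lq_norm q (subtree par v) w)
    (tail_norm q wj S j).
Proof.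
move=> q0 wj0 wE vj.
have -> : (Cst `^ q^-1)^-1 = Cst^-1 `^ q^-1.
  by rewrite -powR_inv1 ?powR_ge0 // powRAC powR_inv1 ?(ltW Cst_gt0).
apply: asymp_poweR; rewrite ?invr_gt0 ?invr_ge0 ?(ltW q0) ?(ltW Cst_gt0) //.
  exact: esum_powR_ge0.
  by apply: esum_ge0 => i _; rewrite lee_fin mulr_ge0 ?powR_ge0 // divr_ge0 ?ltW.
apply: (@esum_subtree_asymp (fun i => wj i `^ q)) => // [i|i x xi].
  exact: powR_ge0.
by rewrite (wE i x xi) ger0_norm.
Qed.

Lemma tail_norm_sup_asymp (q : R) (u w : V -> R) (uj wj : nat -> R) :
  0 < q -> (forall j, 0 <= uj j) -> (forall j, 0 <= wj j) ->
  radial par root u uj -> radial par root w wj ->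
  asymp (Cst `^ q^-1)^-1 (Cst `^ q^-1)
    (tail_norm_sup q uj wj S) (subtree_norm_sup par q u w).
Proof.
move=> q0 uj0 wj0 uE wE.
apply: (asymp_ereal_sup _ _ (matched := level_set par root)).
- by rewrite invr_gt0 powR_gt0.
- exact: powR_ge0.
- exact: level_set_neq0.
- exact: level_setP treeP.
- move=> j x xj; rewrite (uE j x xj); apply: asymp_mull => //.
  by apply: asymp_sym; [rewrite powR_gt0|exact: lq_norm_subtree_asymp].
Qed.

End RegularTree.

Definition level_const (R : realType) (p q Cst Rr : R) : R :=
  peak_const q (pair_ratio p q Rr) * Cst * pair_const p q Rr.

Lemma level_const_gt0 (R : realType) (p q Cst Rr : R) :
  0 < p -> p < q -> 0 < Cst -> 1 < Rr -> 0 < level_const p q Cst Rr.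
Proof.
move=> p0 pq Cst0 Rr1; have sigma1 := pair_ratio_gt1 p0 pq Rr1.
have q0 : 0 < q by apply: lt_trans pq.
have /andP[_ peak1] := powR_Ninv_lt1 q0 sigma1.
have sigma0 : 0 < pair_ratio p q Rr by apply: lt_trans sigma1.
by rewrite !mulr_gt0 ?powR_gt0 ?divr_gt0 ?subr_gt0 ?invr_gt0 ?subr_gt0 ?invf_lt1.
Qed.

Section UpperBound.
Variables (R : realType) (V : choiceType) (par : V -> V) (root : V).
Variables (p q Cst Rr : R) (S : nat -> R).
Hypotheses (p_gt0 : 0 < p) (lt_pq : p < q) (Cst_gt0 : 0 < Cst) (Rr_gt1 : 1 < Rr).
Hypotheses (treeP : is_rooted_tree par root) (S_gt0 : forall j, 0 < S j).
Hypothesis regP : regular_growth par root Cst S.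
Hypothesis S_growth : forall j, Rr * S j <= S j.+1.

Local Notation C := (level_const p q Cst Rr).
Let q_gt0 : 0 < q. Proof. exact: lt_trans lt_pq. Qed.

Section LevelNormBounds.
Variables (f : V -> R) (M : nat -> R).
Hypothesis fM : forall k, (lq_norm p (level_set par root k) f <= (M k)%:E)%E.

Lemma level_bound_ge0 k : 0 <= M k.
Proof. by rewrite -lee_fin (le_trans _ (fM k)) // lq_norm_ge0. Qed.

Lemma ancestor_pair_sum_le i k l : (k <= l)%N -> (l <= i)%N ->
  (\esum_(x in level_set par root i)
     (`|f (ancestor par i k x)| `^ (q - p) * `|f (ancestor par i l x)| `^ p)%:E <=
   (Cst * (S i / S l) * (M k `^ (q - p) * M l `^ p))%:E)%E.
Proof.
move=> kl li; have absf0 x : 0 <= `|f x| `^ p by exact: powR_ge0.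
have CS0 : 0 <= Cst * (S i / S l).
  by rewrite !mulr_ge0 ?invr_ge0 ?(ltW Cst_gt0) ?(ltW (S_gt0 _)).
apply: (@le_trans _ _ (\esum_(x in level_set par root i)
    ((M k `^ (q - p))%:E * (`|f (ancestor par i l x)| `^ p)%:E))%E).
  apply: le_esum => x xi; rewrite -EFinM lee_fin ler_wpM2r //.
  rewrite ler_powR2r ?subr_ge0 ?(ltW lt_pq) // -lee_fin (le_trans _ (fM k)) //.
  apply: normr_le_lq_norm => //; apply: level_set_ancestor xi.
  exact: leq_trans li.
rewrite ge0_esumZl ?powR_ge0 // mulrCA [leRHS]EFinM lee_wpmul2l ?lee_fin ?powR_ge0 //.
apply: le_trans (esum_ancestor_le treeP Cst_gt0 S_gt0 regP absf0 li) _.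
rewrite [leRHS]EFinM lee_wpmul2l ?lee_fin //.
by rewrite -lq_normX // -poweR_EFin lee_poweR2r ?lq_norm_ge0 // ltW.
Qed.

Lemma ancestor_sum_le i :
  (\esum_(x in level_set par root i)
     ((\sum_(k < i.+1) `|f (ancestor par i k x)|) `^ q)%:E <=
   (C * (S i * \sum_(k < i.+1) M k `^ q / S k))%:E)%E.
Proof.
set sigma := pair_ratio p q Rr.
have sigma1 : 1 < sigma by exact: pair_ratio_gt1.
have sigma_ge0 d : 0 <= sigma ^+ d by rewrite exprn_ge0 // (le_trans ler01) // ltW.
pose pair (l k : 'I_i.+1) x := sigma ^+ (l - k) *
  (`|f (ancestor par i k x)| `^ (q - p) * `|f (ancestor par i l x)| `^ p).
have pair0 l k x : 0 <= pair l k x by rewrite !mulr_ge0 ?powR_ge0.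
apply: (@le_trans _ _ (\esum_(x in level_set par root i) ((peak_const q sigma)%:E *
    (\sum_(l < i.+1) \sum_(k < i.+1 | (k <= l)%N) pair l k x)%:E))%E).
  apply: le_esum => x _; rewrite -EFinM lee_fin.
  by apply: powR_sum_le_pair_sum => //; exact: ltW.
rewrite ge0_esumZl ?powR_ge0 //; last first.
  by move=> x; rewrite lee_fin sumr_ge0 // => l _; rewrite sumr_ge0.
rewrite ge0_esum_sumEFin => [|l x]; last by rewrite sumr_ge0.
apply: (@le_trans _ _ ((peak_const q sigma)%:E *
    (\sum_(l < i.+1) \sum_(k < i.+1 | (k <= l)%N)
      sigma ^+ (l - k) * (Cst * (S i / S l) * (M k `^ (q - p) * M l `^ p)))%:E)%E).
  rewrite lee_wpmul2l ?lee_fin ?powR_ge0 // -sumEFin; apply: lee_sum => l _.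
  rewrite ge0_esum_sumEFin // -sumEFin; apply: lee_sum => k kl.
  under eq_esum do rewrite EFinM.
  rewrite ge0_esumZl //.
  by rewrite EFinM lee_wpmul2l ?lee_fin // ancestor_pair_sum_le // -ltnS.
have -> : \sum_(l < i.+1) \sum_(k < i.+1 | (k <= l)%N)
      sigma ^+ (l - k) * (Cst * (S i / S l) * (M k `^ (q - p) * M l `^ p)) =
    Cst * S i * \sum_(l < i.+1) \sum_(k < i.+1 | (k <= l)%N)
      sigma ^+ (l - k) * (M k `^ (q - p) * M l `^ p) / S l.
  rewrite mulr_sumr; apply: eq_bigr => l _; rewrite mulr_sumr; apply: eq_bigr => k _.
  by ring.
have -> : C * (S i * \sum_(k < i.+1) M k `^ q / S k) = peak_const q sigma *
    (Cst * S i * (pair_const p q Rr * \sum_(k < i.+1) M k `^ q / S k)).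
  by rewrite /level_const; ring.
rewrite -EFinM lee_fin ler_wpM2l ?powR_ge0 //
  ler_wpM2l ?mulr_ge0 ?(ltW Cst_gt0) ?(ltW (S_gt0 _)) //.
exact: (sum_growth_pairs_le p_gt0 lt_pq Rr_gt1 S_gt0 S_growth level_bound_ge0).
Qed.

End LevelNormBounds.

Variables (u w : V -> R) (uj wj : nat -> R).
Hypotheses (uj_ge0 : forall j, 0 <= uj j) (wj_ge0 : forall j, 0 <= wj j).
Hypotheses (uE : radial par root u uj) (wE : radial par root w wj).

Lemma Sop_level_le (f : V -> R) (M : nat -> R) i :
  (forall k, (lq_norm p (level_set par root k) f <= (M k)%:E)%E) ->
  (\esum_(x in level_set par root i) (`|Sop par u w f x| `^ q)%:E <=
   C%:E * (\sum_(k < i.+1) (uj k * M k) `^ q * (wj i `^ q * (S i / S k)))%:E)%E.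
Proof.
move=> fM; pose uf x := u x * f x.
have ufM k : (lq_norm p (level_set par root k) uf <= (uj k * M k)%:E)%E.
  rewrite (eq_lq_norm _ (h := fun x => uj k * f x)).
    by rewrite lq_normZ // ger0_norm // EFinM lee_wpmul2l ?lee_fin.
  by move=> x xk; rewrite /uf (uE xk).
apply: (@le_trans _ _ ((wj i `^ q)%:E * \esum_(x in level_set par root i)
    ((\sum_(k < i.+1) `|uf (ancestor par i k x)|) `^ q)%:E)%E).
  rewrite -ge0_esumZl ?powR_ge0 // => [|x]; last by rewrite lee_fin powR_ge0.
  apply: le_esum => x xi.
  rewrite -EFinM lee_fin -powRM ?sumr_ge0 // ler_powR2r ?(ltW q_gt0) //.
  rewrite (Sop_ancestors treeP _ _ _ xi) (wE xi) normrM ger0_norm //.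
  by rewrite ler_wpM2l // ler_norm_sum.
apply: le_trans (lee_wpmul2l _ (ancestor_sum_le ufM i)) _.
  by rewrite lee_fin powR_ge0.
have sumE : wj i `^ q * (S i * \sum_(k < i.+1) (uj k * M k) `^ q / S k) =
    \sum_(k < i.+1) (uj k * M k) `^ q * (wj i `^ q * (S i / S k)).
  by rewrite !mulr_sumr; apply: eq_bigr => k _; ring.
by rewrite -!EFinM mulrCA sumE.
Qed.

Lemma lq_norm_Sop_le (f : V -> R) (b : R) :
  0 <= b -> (forall k, (uj k)%:E * tail_norm q wj S k <= b%:E)%E ->
  (lqlp_norm par root p q f < +oo)%E ->
  (lq_norm q [set: V] (Sop par u w f) <=
   (C `^ q^-1 * b)%:E * lqlp_norm par root p q f)%E.
Proof.
move=> b0 uTb f_fin.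
have C0 : 0 <= C by rewrite ltW ?level_const_gt0.
pose M k := fine (lq_norm p (level_set par root k) f).
have ME k : lq_norm p (level_set par root k) f = (M k)%:E.
  by rewrite fineK // ge0_fin_numE ?lq_norm_ge0 // (lq_norm_level_lty _ q_gt0 f_fin).
have M0 k : 0 <= M k by rewrite fine_ge0 ?lq_norm_ge0.
have MqE : (\esum_(j in [set: nat]) lq_norm p (level_set par root j) f `^ q =
    \esum_(j in [set: nat]) (M j `^ q)%:E)%E.
  by apply: eq_esum => j _; rewrite ME.
have -> : C `^ q^-1 * b = (C * b `^ q) `^ q^-1.
  by rewrite powRM ?powR_ge0 // -powRrM mulfV ?gt_eqF // powRr1.
have Cb0 : 0 <= C * b `^ q by rewrite mulr_ge0 ?powR_ge0.
rewrite lqlp_normE MqE -poweR_EFin -poweRM ?lee_fin //; last first.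
  by apply: esum_ge0 => j _; rewrite lee_fin powR_ge0.
apply: lee_poweR2r; [by rewrite invr_ge0 ltW|exact: esum_powR_ge0|].
rewrite (esum_levels treeP) => [|x]; last by rewrite lee_fin powR_ge0.
rewrite EFinM -muleA.
apply: le_trans (lee_wpmul2l _ (esum_tail_norm_le q_gt0 S_gt0 uj_ge0 M0 uTb)); last first.
  by rewrite lee_fin.
rewrite -ge0_esumZl // => [|i].
  by apply: le_esum => i _; apply: Sop_level_le => k; rewrite ME.
by rewrite lee_fin sumr_ge0 // => k _; rewrite !mulr_ge0 ?powR_ge0 ?invr_ge0 ?ltW.
Qed.

Lemma op_norm_le :
  (op_norm par root p q u w <= (C `^ q^-1)%:E * tail_norm_sup q uj wj S)%E.
Proof.
set B := tail_norm_sup _ _ _ _.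
have uTB k : ((uj k)%:E * tail_norm q wj S k <= B)%E by apply: ereal_sup_ubound; exists k.
have B0 : (0 <= B)%E by rewrite (le_trans _ (uTB 0)) // mule_ge0 ?poweR_ge0 ?lee_fin.
have C0 : 0 < C `^ q^-1 by rewrite powR_gt0 ?level_const_gt0.
case: B B0 uTB => [b| |] // b0 uTb; last by rewrite mulry gtr0_sg // mul1e leey.
rewrite -EFinM; apply: ereal_inf_lbound; split.
  by rewrite lee_fin mulr_ge0 // ltW.
by move=> f; apply: lq_norm_Sop_le.
Qed.

End UpperBound.

Section LowerBound.
Variables (R : realType) (V : choiceType) (par : V -> V) (root : V) (p q : R).
Hypotheses (p_gt0 : 0 < p) (q_gt0 : 0 < q) (treeP : is_rooted_tree par root).

Lemma lqlp_norm_indic1 (x : V) : lqlp_norm par root p q (\1_[set x] : V -> R) = 1%E.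
Proof.
have [j xj] := level_setP treeP x.
rewrite lqlp_normE (@esum_single _ _ _ _ j) ?poweR_ge0 // => [|k _ kj].
  by rewrite lq_norm_indic1 // indicE mem_set // !poweR1r.
rewrite lq_norm_indic1 // indicE memNset ?poweR0r ?gt_eqF // => xk.
by apply: kj; exact: level_set_uniq xk xj.
Qed.

Lemma Sop_indic1 (u w : V -> R) (x y : V) :
  tle par x y -> Sop par u w \1_[set x] y = u x * w y.
Proof.
move=> xy; rewrite /Sop -(@fsbig_widen _ _ _ _ [set x]) /=; last 2 first.
- by move=> _ ->.
- by move=> z [_ /= zx]; rewrite indicE memNset ?mulr0.
by rewrite fsbig_set1 indicE mem_set // mulr1 mulrC.
Qed.

Lemma op_norm_ge (u w : V -> R) : (forall x, 0 <= u x) ->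
  (subtree_norm_sup par q u w <= op_norm par root p q u w)%E.
Proof.
move=> u0; apply: ge_ereal_sup => _ [x _ <-].
apply: le_ereal_inf_tmp => C [_ /(_ \1_[set x])]; rewrite lqlp_norm_indic1 mule1.
move=> /(_ (ltry _)); apply: le_trans.
apply: le_trans (lq_norm_subset_le q_gt0 _ (@subsetT _ (subtree par x))).
rewrite -{1}(ger0_norm (u0 x)) -lq_normZ //.
by rewrite (eq_lq_norm _ (h := fun y => u x * w y)) // => y; exact: Sop_indic1.
Qed.

End LowerBound.

Theorem theorem2 (R : realType) (p q Cst Rr R0 : R) :
  1 < p -> p < q -> 1 <= Cst -> 1 < Rr -> Rr <= R0 ->
  exists c1 c2 : R, 0 < c1 /\ 0 < c2 /\
  forall (V : countType) (par : V -> V) (root : V)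
         (u w : V -> R) (uj wj : nat -> R) (S : nat -> R),
    is_rooted_tree par root ->
    (forall j, 0 <= uj j) -> (forall j, 0 <= wj j) ->
    (forall j xi, level_set par root j xi -> u xi = uj j /\ w xi = wj j) ->
    (forall j, 0 < S j) ->
    (forall j xi j', level_set par root j xi -> (j <= j')%N ->
       ((Cst^-1 * (S j' / S j))%:E <= \esum_(y in level_set par xi (j' - j)) 1
        /\ \esum_(y in level_set par xi (j' - j)) 1 <= (Cst * (S j' / S j))%:E)%E) ->
    S 0%N = 1 ->
    (forall j, S j.+1 / S j <= R0 /\ Rr <= S j.+1 / S j) ->
    let A := op_norm par root p q u w in
    let B1 := ereal_sup [set ((uj j)%:E *
                  (\esum_(i in [set i : nat | (j <= i)%N])
                      ((wj i `^ q * (S i / S j))%:E)) `^ q^-1)%E | j in [set: nat]] in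
    let B2 := ereal_sup [set ((u xi)%:E * lq_norm q (subtree par xi) w)%E
                        | xi in [set: V]] in
    asymp c1 c2 A B1 /\ asymp c1 c2 B1 B2 /\ asymp c1 c2 A B2.
Proof.
move=> p1 pq Cst1 Rr1 _.
have [p0 q0 Cst0] : [/\ 0 < p, 0 < q & 0 < Cst] by split; lra.
pose D := level_const p q Cst Rr `^ q^-1; pose k := Cst `^ q^-1.
have D0 : 0 < D by rewrite powR_gt0 ?level_const_gt0.
have k1 : 1 <= k by rewrite -(powRr0 Cst) ler_powR // invr_ge0 ltW.
have k0 : 0 < k by rewrite powR_gt0.
exists k^-1, ((D + 1) * k); split; first by rewrite invr_gt0.
split; first by rewrite mulr_gt0 // addr_gt0.
move=> V par root u w uj wj S treeP uj0 wj0 uw S0 regP _ ratioP A B1 B2.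
have uE : radial par root u uj by move=> j x /uw[].
have wE : radial par root w wj by move=> j x /uw[].
have S_growth j : Rr * S j <= S j.+1 by have [_] := ratioP j; rewrite ler_pdivlMr.
have u0 := radial_ge0 treeP uj0 uE.
have B2_ge0 : (0 <= B2)%E.
  apply: le_trans (ereal_sup_ubound _); last by exists root.
  by rewrite mule_ge0 ?lee_fin ?lq_norm_ge0.
apply: (asymp_triangle D0 k1 (lexx _) B2_ge0).
- exact: op_norm_ge.
- exact: (op_norm_le p0 pq Cst0 Rr1 treeP S0 regP S_growth).
- exact: (tail_norm_sup_asymp treeP Cst0 S0 regP q0 uj0 wj0 uE wE).
Qed.
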